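(* Let $Q$ be a translation-commutative quandle, and suppose there is a bijection $b\leftrightarrow Q_b$ between a nonempty set $B$ and the set of orbits of $Q$. Then there is a family $S=\{S_b\mid b\in B\}$ of subgroups of $\mathbb Z_B$, with $b\in S_b$ for all $b\in B$, such that $Q\cong Q(S)$.
   Context: A quandle is a set $Q$ with a binary operation $\triangleright$ such that: $x\triangleright x=x$ for all $x$; for each $y\in Q$ the map $\beta_y(x)=x\triangleright y$ is a bijection $Q\to Q$ (a translation); and $(w\triangleright x)\triangleright y=(w\triangleright y)\triangleright(x\triangleright y)$ for all $w,x,y$. Isomorphisms ($\cong$) are bijections preserving $\triangleright$. A quandle is translation-commutative if the group generated by its translations $\beta_y$ is commutative, equivalently $(x\triangleright y)\triangleright z=(x\triangleright z)\triangleright y$ for all $x,y,z$. The orbit of $x\in Q$ is the smallest subset $Q_x\subseteq Q$ with $x\in Q_x$ and $\beta_y^{\pm1}(z)\in Q_x$ for all $y\in Q$, $z\in Q_x$. For a nonempty set $B$, $\mathbb Z_B$ is the free abelian group on $B$. If $S=\{S_b\mid b\in B\}$ is a family of subgroups of $\mathbb Z_B$ with $b\in S_b$ for all $b\in B$, put $A_b=\mathbb Z_B/S_b$; then $Q(S)$ is the disjoint union $\bigcup_{b\in B}A_b$ with operation $x\triangleright y=x+(c+S_b)\in A_b$ for $x\in A_b$, $y\in A_c$. *)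

(* Defs.v *)
From HB Require Import structures.
From mathcomp Require Import all_boot all_order all_algebra.
From mathcomp Require Import boolp classical_sets functions.
From mathcomp Require Import freeg.

Set Implicit Arguments.
Unset Strict Implicit.
Unset Printing Implicit Defensive.

Import GRing.Theory.

Local Open Scope classical_set_scope.
Local Open Scope ring_scope.
Local Open Scope quotient_scope.

Reserved Notation "x |> y" (at level 50, left associativity).

HB.mixin Record isQuandle (Q : Type) := {
  qop : Q -> Q -> Q;
  qop_idem : forall x, qop x x = x;
  qop_bij : forall y, bijective (fun x => qop x y);
  qop_dist : forall w x y, qop (qop w x) y = qop (qop w y) (qop x y)
}.

#[short(type="quandleType")]
HB.structure Definition Quandle := {Q of isQuandle Q}.

Notation "x |> y" := (qop x y).

Definition translation (Q : quandleType) (y : Q) : Q -> Q := fun x => x |> y.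

Definition quandle_iso (Q Q' : quandleType) : Prop :=
  exists f : Q -> Q', bijective f /\ {morph f : x y / x |> y >-> x |> y}.

(* When G consists of bijections of T, this says that G is a subgroup of the
   group of all bijections of T: the inverse of a bijection f is the unique g
   such that f and g cancel each other on both sides. *)
Definition subgroup_closed (T : Type) (G : set (T -> T)) : Prop :=
  [/\ G idfun,
      forall f g, G f -> G g -> G (f \o g)
    & forall f g, cancel f g -> cancel g f -> G f -> G g].

Definition translation_group (Q : quandleType) : set (Q -> Q) :=
  smallest (@subgroup_closed Q) (range (@translation Q)).

Definition translation_commutative (Q : quandleType) : Prop :=
  forall f g : Q -> Q,
    translation_group f -> translation_group g -> f \o g = g \o f.

(* Closure under the inverse translations is expressed with the preimage:
   as [translation y] is a bijection, [translation y @^-1` A] is the image of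
   [A] by its inverse. *)
Definition translation_closed (Q : quandleType) (A : set Q) : Prop :=
  forall y : Q, translation y @` A `<=` A /\ translation y @^-1` A `<=` A.

Definition qorbit (Q : quandleType) (x : Q) : set Q :=
  smallest (@translation_closed Q) [set x].

Definition qorbits (Q : quandleType) : set (set Q) := range (@qorbit Q).
Arguments qorbits : clear implicits.

(* [{classic B}] is [B] itself with a choice structure, which [{freeg _}]
   requires. *)
Definition free_abelian (B : Type) : zmodType := {freeg {classic B}}.

Definition fgen (B : Type) (b : B) : free_abelian B := << (b : {classic B}) >>.

Section CosetQuandle.
Variables (B : Type) (S : B -> zmodClosed (free_abelian B)).

Definition coset_quandle of (forall b, fgen b \in S b) : Type :=
  {b : B & {ideal_quot S b}}.

Hypothesis fgen_S : forall b, fgen b \in S b.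

Definition coset_op (x y : coset_quandle fgen_S) : coset_quandle fgen_S :=
  Tagged (fun b => {ideal_quot S b})
    (tagged x + \pi_({ideal_quot S (tag x)}) (fgen (tag y))).

Lemma coset_op_idem x : coset_op x x = x.
Proof.
case: x => b x; rewrite /coset_op /=; congr existT.
suff -> : \pi_({ideal_quot S b}) (fgen b) = 0 by rewrite addr0.
by apply/eqP; rewrite piE Quotient.equivE subr0 fgen_S.
Qed.

Lemma coset_op_bij y : bijective (fun x => coset_op x y).
Proof.
exists (fun x : coset_quandle fgen_S => Tagged (fun b => {ideal_quot S b})
  (tagged x - \pi_({ideal_quot S (tag x)}) (fgen (tag y)))) => -[b x];
  rewrite /coset_op /=; congr existT.
- exact: addrK.
- exact: subrK.
Qed.

Lemma coset_op_dist w x y :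
  coset_op (coset_op w x) y = coset_op (coset_op w y) (coset_op x y).
Proof. by rewrite /coset_op /=; congr existT; rewrite addrAC. Qed.

HB.instance Definition _ :=
  isQuandle.Build (coset_quandle fgen_S) coset_op_idem coset_op_bij coset_op_dist.

End CosetQuandle.

(* Main.v *)
Require Import Defs.
From HB Require Import structures.
From mathcomp Require Import all_boot all_order all_algebra.
From mathcomp Require Import boolp classical_sets functions.
From mathcomp Require Import generic_quotient ring_quotient freeg.

Set Implicit Arguments.
Unset Strict Implicit.
Unset Printing Implicit Defensive.

Import GRing.Theory.

(** In a translation-commutative quandle [y] and [y |> z] define the same
translation ([translation_qop]), so a translation depends only on the orbit of
its index. Choose a point [r b] in each orbit. The translations by the points
[r b] are then all the translations, and since the translation group is
abelian, sending the generator [b] to the translation by [r b] defines an action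
of the free abelian group on [B] on the quandle, whose image is the whole
translation group. Its orbits are therefore the orbits of the quandle, and
the orbit of [r b] is identified with the quotient by the stabilizer [S_b] of
[r b]. Idempotence says that the generator [b] fixes [r b], so that [b] lies in
[S_b]. Under this identification, applying [_ |> y] with [y] in the orbit of
[r c] is acting by the generator [c], which on cosets is the addition of the
class of [c]; this is the operation of the coset quandle.

The isomorphism is constructed from the coset quandle to [Q], sending the class
of [D] modulo [S_b] to the image of [r b] under [D]: the other direction would
require choosing some [D] for each point. *)

Local Open Scope classical_set_scope.

(** * The translation group and the orbits of a quandle *)

Section TranslationGroup.
Variable Q : quandleType.
Implicit Types (x y z : Q) (f g : Q -> Q).

Lemma translation_group_ind (P : (Q -> Q) -> Prop) :
    subgroup_closed P -> (forall y, P (translation y)) ->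
  forall f, translation_group f -> P f.
Proof. by move=> Psub PT f; apply; split=> // _ [y _ <-]; apply: PT. Qed.

Lemma translation_group_id : translation_group (idfun : Q -> Q).
Proof. by move=> G [[]]. Qed.

Lemma translation_group_comp f g :
  translation_group f -> translation_group g -> translation_group (f \o g).
Proof.
move=> tf tg G GP; have [[_ Gcomp _] _] := GP.
exact: Gcomp (tf G GP) (tg G GP).
Qed.

Lemma translation_group_inverse f g :
  cancel f g -> cancel g f -> translation_group f -> translation_group g.
Proof.
move=> fK gK tf G GP; have [[_ _ Ginv] _] := GP.
exact: Ginv fK gK (tf G GP).
Qed.

Lemma translation_in_group y : translation_group (translation y).
Proof. by move=> G [_]; apply; exists y. Qed.

(** Bijectivity has to be proved by induction: [subgroup_closed] constrains sets of
arbitrary maps, and the range of [translation] consists of bijections. *)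
Lemma translation_group_inv f : translation_group f ->
  exists g, [/\ translation_group g, cancel f g & cancel g f].
Proof.
move=> tf; suff [g fK gK] : bijective f.
  by exists g; split=> //; apply: translation_group_inverse tf.
apply: translation_group_ind tf => [|y]; last exact: qop_bij.
split=> [|f1 f2|f1 f2 f1K f2K _].
- exact: inv_bij.
- exact: bij_comp.
- by exists f1.
Qed.

(** The set on the right is closed under translations and their inverses, as
the translation group contains both; conversely, the maps that preserve a
given closed set in both directions form a subgroup containing the
translations. *)
Lemma qorbitE x : qorbit x = [set f x | f in @translation_group Q].
Proof.
apply/seteqP; split.
- apply: smallest_sub => [y|_ ->]; last first.
    by exists idfun => //; exact: translation_group_id.
  split=> [_ [_ [f tf <-] <-]|z [f tf fxE]].
    exists (translation y \o f) => //.
    by apply: translation_group_comp tf; exact: translation_in_group.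
  have [g [tg yK _]] := translation_group_inv (translation_in_group y).
  exists (g \o f); first exact: translation_group_comp.
  by rewrite /= fxE yK.
- move=> _ [f tf <-] A [Acl Ax].
  have {Ax} : A x by apply: Ax.
  (* The induction needs the preimages too, to handle inverses. *)
  suff [fA _] : f @` A `<=` A /\ f @^-1` A `<=` A by move=> Ax; apply: fA; exists x.
  move: f tf; apply: translation_group_ind => // {x}.
  split=> [|f g [fA fAV] [gA gAV]|f g fK gK [fA fAV]].
  + by split=> // _ [x Ax <-].
  + split=> [_ [x Ax <-]|x Afgx]; last exact/gAV/fAV.
    by apply: fA; exists (g x) => //; apply: gA; exists x.
  + split=> [_ [x Ax <-]|x Agx]; first by apply: fAV; rewrite /preimage /= gK.
    by apply: fA; exists (g x).
Qed.

Lemma qorbit_id x : qorbit x x.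
Proof. by move=> A [_]; apply. Qed.

Lemma qorbit_sym x y : qorbit x y -> qorbit y x.
Proof.
rewrite !qorbitE => -[f /translation_group_inv[g [tg fK _]] <-].
by exists g; rewrite ?fK.
Qed.

Lemma qorbit_eq x y : qorbit x y -> qorbit x = qorbit y.
Proof.
have sub (u v : Q) : qorbit u v -> qorbit v `<=` qorbit u.
  rewrite !qorbitE => -[f tf <-] _ [g tg <-].
  by exists (g \o f) => //; exact: translation_group_comp.
by move=> xy; apply/seteqP; split; apply: sub => //; exact: qorbit_sym.
Qed.

End TranslationGroup.

(** * The abelian group of translations *)

Section AbelianTranslations.
Variables (Q : quandleType) (comm : translation_commutative Q).

(** By distributivity and commutativity, [(w |> y) |> z = (w |> z) |> (y |> z)
= (w |> (y |> z)) |> z], where [_ |> z] can be cancelled. *)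
Lemma translation_qop (y z : Q) : translation (y |> z) = translation y.
Proof.
apply/funext=> w; apply: (bij_inj (qop_bij z)).
have /(congr1 (fun f => f w)) /= := comm (translation_in_group z)
  (translation_in_group (y |> z)).
by rewrite /translation /= => ->; rewrite -qop_dist.
Qed.

Lemma translation_qorbit (x y : Q) : qorbit x y -> translation y = translation x.
Proof.
suff sub : qorbit x `<=` [set y | translation y = translation x] by exact: sub.
apply: smallest_sub => [z|_ ->//]; split=> [_ [w + <-]|w] /=;
  by rewrite [translation z w]/(w |> z) translation_qop.
Qed.

(** A type depending on the commutativity hypothesis, so that it can carry the
structure of an additive group; the group law is composition. *)
Definition abelian_translations of translation_commutative Q : Type :=
  {f : Q -> Q | translation_group f}.
Local Notation G := (abelian_translations comm).

HB.instance Definition _ := gen_eqMixin G.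
HB.instance Definition _ := gen_choiceMixin G.

Lemma abelian_translations_eq (f g : G) : sval f = sval g -> f = g.
Proof. by case: f g => [f ?] [g ?]; exact: eq_exist. Qed.

Definition at_zero : G := exist _ _ (@translation_group_id Q).

Definition at_add (f g : G) : G :=
  exist _ _ (translation_group_comp (svalP f) (svalP g)).

Lemma at_opp_subproof (f : G) :
  {g | [/\ translation_group g, cancel (sval f) g & cancel g (sval f)]}.
Proof. exact/cid/translation_group_inv/svalP. Qed.

Definition at_opp (f : G) : G :=
  let: exist g gP := at_opp_subproof f in
  exist _ g (let: And3 tg _ _ := gP in tg).

Lemma at_addA : associative at_add.
Proof. by move=> f g h; apply: abelian_translations_eq. Qed.

Lemma at_addC : commutative at_add.
Proof. by move=> f g; apply: abelian_translations_eq; apply: comm; apply: svalP. Qed.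

Lemma at_add0 : left_id at_zero at_add.
Proof. by move=> f; apply: abelian_translations_eq. Qed.

Lemma at_addN : left_inverse at_zero at_opp at_add.
Proof.
move=> f; apply: abelian_translations_eq; apply/funext => x.
by rewrite /at_opp /=; case: at_opp_subproof => g [? fK ?] /=; rewrite fK.
Qed.

HB.instance Definition _ := GRing.isZmodule.Build G at_addA at_addC at_add0 at_addN.

End AbelianTranslations.

(** * The action of the free abelian group *)

Section FreeAction.
Local Open Scope ring_scope.
Variables (Q : quandleType) (comm : translation_commutative Q).
Variables (B : Type) (r : B -> Q).
Implicit Types (D E : free_abelian B) (x : Q).

Definition gen_translation (b : {classic B}) : abelian_translations comm :=
  exist _ _ (translation_in_group (r b)).

(** The integer-linear extension of [gen_translation]; [zmodule] is the view of
an additive group as a module over the integers. *)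
Definition free_hom : free_abelian B -> abelian_translations comm :=
  fglift (gen_translation : _ -> zmodule (abelian_translations comm)).

Lemma free_hom_is_additive : zmod_morphism free_hom.
Proof. by move=> D E; apply: (lift_is_additive (M := zmodule _)). Qed.

HB.instance Definition _ := GRing.isZmodMorphism.Build
  (free_abelian B) (abelian_translations comm) free_hom free_hom_is_additive.

Definition free_act D : Q -> Q := sval (free_hom D).

Lemma free_act_group D : translation_group (free_act D).
Proof. exact: svalP. Qed.

Lemma free_actD D E x : free_act (D + E) x = free_act D (free_act E x).
Proof. by rewrite /free_act raddfD. Qed.

Lemma free_act0 x : free_act 0 x = x.
Proof. by rewrite /free_act raddf0. Qed.

Lemma free_actK D : cancel (free_act D) (free_act (- D)).
Proof. by move=> x; rewrite -free_actD addNr free_act0. Qed.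

Lemma free_actNK D : cancel (free_act (- D)) (free_act D).
Proof. by move=> x; rewrite -free_actD addrN free_act0. Qed.

Lemma free_act_gen b : free_act (fgen b) = translation (r b).
Proof. by rewrite /free_act /free_hom /fgen liftU scale1r. Qed.

Lemma qorbit_free_act D x : qorbit x (free_act D x).
Proof. by rewrite qorbitE; exists (free_act D) => //; exact: free_act_group. Qed.

(** The translations by representatives of the orbits are all the
translations, so the action exhausts the translation group. *)
Lemma qorbit_free_actP (x y : Q) :
  (forall z, exists b, qorbit z (r b)) -> qorbit x y -> exists D, free_act D x = y.
Proof.
move=> r_meets; rewrite qorbitE => -[f tf <-].
suff [D ->] : exists D, f = free_act D by exists D.
move: f tf; apply: translation_group_ind => [|z]; last first.
  have [b zb] := r_meets z.
  by exists (fgen b); rewrite free_act_gen (translation_qorbit comm zb).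
split=> [|_ _ [D ->] [E ->]|f g fK gK [D fE]].
- by exists 0; apply/funext => z; rewrite free_act0.
- by exists (D + E); apply/funext => z; rewrite free_actD.
- exists (- D); apply/funext => z.
  by apply: (can_inj fK); rewrite gK fE free_actNK.
Qed.

Definition stabilizer x : {pred free_abelian B} := fun D => `[< free_act D x = x >].

Lemma stabilizerP x D : reflect (free_act D x = x) (D \in stabilizer x).
Proof. exact: asboolP. Qed.

Lemma stabilizer_zmod_closed x : zmod_closed (stabilizer x).
Proof.
split; first by apply/stabilizerP; rewrite free_act0.
move=> D E /stabilizerP Dx /stabilizerP Ex; apply/stabilizerP.
by rewrite free_actD -{1}Ex free_actK.
Qed.

HB.instance Definition _ x :=
  GRing.isZmodClosed.Build (free_abelian B) (stabilizer x) (stabilizer_zmod_closed x).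

Lemma fgen_stabilizer b : fgen b \in stabilizer (r b).
Proof. by apply/stabilizerP; rewrite free_act_gen; exact: qop_idem. Qed.

Lemma free_act_stabilizer x D E :
  D - E \in stabilizer x <-> free_act D x = free_act E x.
Proof.
rewrite addrC; split=> [/stabilizerP|DE].
  by rewrite free_actD => /(congr1 (free_act E)); rewrite free_actNK.
by apply/stabilizerP; rewrite free_actD DE free_actK.
Qed.

(** * The isomorphism with the coset quandle *)

Definition stab_family (b : B) : zmodClosed (free_abelian B) := stabilizer (r b).

Local Notation stab_quandle := (coset_quandle (S := stab_family) fgen_stabilizer).

Definition coset b D : stab_quandle :=
  Tagged (fun b => {ideal_quot (stab_family b)})
    (\pi_({ideal_quot (stab_family b)})%qT D).

Definition from_coset (p : stab_quandle) : Q :=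
  free_act (repr (tagged p)) (r (tag p)).

(** Orbit-stabilizer at [r b]: this is at once the independence of [from_coset]
from the chosen representatives and its injectivity on each component. *)
Lemma stab_family_piP b D E :
  (D = E %[mod {ideal_quot (stab_family b)}])%qT <->
  free_act D (r b) = free_act E (r b).
Proof.
apply: iff_trans (free_act_stabilizer _ _ _).
by rewrite [_ \in _](Quotient.idealrBE (stab_family b)); split=> /eqP.
Qed.

Lemma from_coset_pi b D : from_coset (coset b D) = free_act D (r b).
Proof. by apply/stab_family_piP; rewrite reprK. Qed.

(** The image of the coset [q] lies in the orbit of [r (tag q)], so translating
by it is acting by the generator [tag q]. *)
Lemma from_coset_morph : {morph from_coset : p q / p |> q >-> p |> q}.
Proof.
move=> [b X] [c Y]; rewrite -[X]reprK -[Y]reprK.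
rewrite [LHS](_ : _ = from_coset (coset b (fgen c + repr X))); last first.
  congr (from_coset (existT _ _ _)); rewrite /= addrC.
  exact/esym/raddfD.
rewrite !from_coset_pi free_actD free_act_gen.
by rewrite -(translation_qorbit comm (@qorbit_free_act (repr Y) (r c))).
Qed.

(** Injectivity across components and surjectivity hold because the points
[r b] meet every orbit exactly once. *)
Lemma from_coset_bij : (forall z, exists! b, qorbit z (r b)) -> bijective from_coset.
Proof.
move=> r_transversal; have back D b : qorbit (free_act D (r b)) (r b).
  by apply: qorbit_sym; exact: qorbit_free_act.
rewrite -setTT_bijective; split=> //.
- move=> [b X] [c Y] _ _; rewrite -[X]reprK -[Y]reprK !from_coset_pi => XYE.
  have [a [_ a_uniq]] := r_transversal (free_act (repr X) (r b)).
  have ab : a = b by apply: a_uniq; exact: back.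
  have ac : a = c by apply: a_uniq; rewrite XYE; exact: back.
  rewrite {}ab in ac; subst c; congr existT.
  exact/stab_family_piP.
- move=> x _; have [b [xb _]] := r_transversal x.
  have [D <-] : exists D, free_act D (r b) = x.
    apply: qorbit_free_actP (qorbit_sym xb) => z.
    by have [c [zc _]] := r_transversal z; exists c.
  by exists (coset b D); rewrite ?from_coset_pi.
Qed.

End FreeAction.

Theorem theorem16 (Q : quandleType) (B : Type) (O : B -> set Q) :
  translation_commutative Q ->
  [set: B] !=set0 ->
  set_bij [set: B] (qorbits Q) O ->
  exists (S : B -> zmodClosed (free_abelian B))
         (fgen_S : forall b : B, fgen b \in S b),
    quandle_iso Q (coset_quandle fgen_S).
Proof.
move=> comm _ [O_orbit O_inj O_surj].
have /choice[r rE] : forall b, exists x, qorbit x = O b.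
  by move=> b; have [x _ xE] := O_orbit b I; exists x.
have r_transversal z : exists! b, qorbit z (r b).
  have [b _ Ob] : (O @` setT) (qorbit z) by apply: O_surj; exists z.
  exists b; split=> [|c /qorbit_eq zc].
    by rewrite -Ob -rE; exact: qorbit_id.
  by apply: O_inj; rewrite ?inE // Ob -rE -zc.
exists (stab_family comm r), (fgen_stabilizer comm r).
have [g fK gK] := from_coset_bij comm r_transversal.
exists g; split; first by exists (@from_coset _ comm _ r).
by move=> x y; apply: (can_inj fK); rewrite from_coset_morph !gK.
Qed.
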